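(* Let $a,b,c$ be positive integers with $\max\{a,b,c\}>1$, and let $i,j,k\ge 3$ be integers with $i\le j\le k$ and $\max\{i,j,k\}\ge 5$. Suppose that $(ap_i,bp_j,cp_k)$ is universal (over $\mathbb{N}$), with $a\le b$ if $i=j$, and $b\le c$ if $j=k$. Then $(ap_i,bp_j,cp_k)$ is on the following list of $64$ triples: $$(p_3,p_3,2p_5),\ (p_3,p_3,4p_5),\ (p_3,2p_3,p_5),\ (p_3,2p_3,4p_5),\ (p_3,3p_3,p_5),$$ $$(p_3,4p_3,p_5),\ (p_3,4p_3,2p_5),\ (p_3,6p_3,p_5),\ (p_3,9p_3,p_5),\ (2p_3,3p_3,p_5),$$ $$(p_3,2p_3,p_6),\ (p_3,2p_3,2p_6),\ (p_3,2p_3,p_7),\ (p_3,2p_3,2p_7),\ (p_3,2p_3,p_8),$$ $$(p_3,2p_3,2p_8),\ (p_3,2p_3,p_9),\ (p_3,2p_3,2p_9),\ (p_3,2p_3,p_{10}),\ (p_3,2p_3,p_{12}),$$ $$(p_3,2p_3,2p_{12}),\ (p_3,2p_3,p_{15}),\ (p_3,2p_3,p_{16}),\ (p_3,2p_3,p_{17}),\ (p_3,2p_3,p_{23}),$$ $$(p_3,p_4,2p_5),\ (p_3,2p_4,p_5),\ (p_3,2p_4,2p_5),\ (p_3,2p_4,4p_5),\ (p_3,3p_4,p_5),$$ $$(p_3,4p_4,p_5),\ (p_3,4p_4,2p_5),\ (2p_3,p_4,p_5),\ (2p_3,p_4,2p_5),\ (2p_3,p_4,4p_5),$$ $$(2p_3,3p_4,p_5),\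 (3p_3,p_4,p_5),\ (p_3,2p_4,p_6),\ (2p_3,p_4,p_6),\ (p_3,p_4,2p_7),$$ $$(2p_3,p_4,p_7),\ (p_3,p_4,2p_8),\ (p_3,2p_4,p_8),\ (p_3,3p_4,p_8),\ (2p_3,p_4,p_8),$$ $$(2p_3,3p_4,p_8),\ (p_3,p_4,2p_9),\ (p_3,2p_4,p_9),\ (2p_3,p_4,p_{10}),\ (2p_3,p_4,p_{12}),$$ $$(p_3,2p_4,p_{17}),\ (2p_3,p_4,p_{17}),\ (p_3,p_5,4p_6),\ (p_3,2p_5,p_6),\ (p_3,p_5,2p_7),$$ $$(p_3,p_5,4p_7),\ (p_3,2p_5,p_7),\ (3p_3,p_5,p_7),\ (p_3,p_5,2p_9),\ (2p_3,p_5,p_9),$$ $$(p_3,2p_6,p_8),\ (p_3,p_7,2p_7),\ (p_4,2p_4,p_5),\ (2p_4,p_5,p_6).$$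
   Context: $\mathbb{N}=\{0,1,2,\ldots\}$. For an integer $m\ge 3$ and $x\in\mathbb{N}$, $p_m(x)=\frac{(m-2)x^2-(m-4)x}{2}$. For positive integers $a,b,c$ and integers $i,j,k\ge 3$, the triple $(ap_i,bp_j,cp_k)$ is called universal (over $\mathbb{N}$) if every $n\in\mathbb{N}$ can be written as $n=ap_i(x)+bp_j(y)+cp_k(z)$ with $x,y,z\in\mathbb{N}$. In writing triples, $p_m$ means $1\cdot p_m$; the triple $(ap_i,bp_j,cp_k)$ is identified with the data $((a,i),(b,j),(c,k))$. *)

(* Defs.v *)
From mathcomp Require Import all_boot all_order all_algebra.

Set Implicit Arguments.
Unset Strict Implicit.
Unset Printing Implicit Defensive.

Import GRing.Theory.

Local Open Scope ring_scope.

(* Rational-valued so that neither the division by 2 nor the subtraction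
   m - 4 is truncated (m - 4 is negative for m = 3). *)
Definition polygonal (m x : nat) : rat :=
  ((m%:R - 2) * x%:R ^+ 2 - (m%:R - 4) * x%:R) / 2.

(* ((a, i), (b, j), (c, k)) stands for (a p_i, b p_j, c p_k). *)
Definition polygonal_triple : Type := (nat * nat) * (nat * nat) * (nat * nat).

Definition universal (t : polygonal_triple) : Prop :=
  let: ((a, i), (b, j), (c, k)) := t in
  forall n : nat, exists x y z : nat,
    n%:R = a%:R * polygonal i x + b%:R * polygonal j y + c%:R * polygonal k z.

Local Open Scope nat_scope.

Definition universal_list : seq polygonal_triple :=
  [:: ((1, 3), (1, 3), (2, 5)); ((1, 3), (1, 3), (4, 5)); ((1, 3), (2, 3), (1, 5));
      ((1, 3), (2, 3), (4, 5)); ((1, 3), (3, 3), (1, 5)); ((1, 3), (4, 3), (1, 5));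
      ((1, 3), (4, 3), (2, 5)); ((1, 3), (6, 3), (1, 5)); ((1, 3), (9, 3), (1, 5));
      ((2, 3), (3, 3), (1, 5)); ((1, 3), (2, 3), (1, 6)); ((1, 3), (2, 3), (2, 6));
      ((1, 3), (2, 3), (1, 7)); ((1, 3), (2, 3), (2, 7)); ((1, 3), (2, 3), (1, 8));
      ((1, 3), (2, 3), (2, 8)); ((1, 3), (2, 3), (1, 9)); ((1, 3), (2, 3), (2, 9));
      ((1, 3), (2, 3), (1, 10)); ((1, 3), (2, 3), (1, 12)); ((1, 3), (2, 3), (2, 12));
      ((1, 3), (2, 3), (1, 15)); ((1, 3), (2, 3), (1, 16)); ((1, 3), (2, 3), (1, 17));
      ((1, 3), (2, 3), (1, 23)); ((1, 3), (1, 4), (2, 5)); ((1, 3), (2, 4), (1, 5));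
      ((1, 3), (2, 4), (2, 5)); ((1, 3), (2, 4), (4, 5)); ((1, 3), (3, 4), (1, 5));
      ((1, 3), (4, 4), (1, 5)); ((1, 3), (4, 4), (2, 5)); ((2, 3), (1, 4), (1, 5));
      ((2, 3), (1, 4), (2, 5)); ((2, 3), (1, 4), (4, 5)); ((2, 3), (3, 4), (1, 5));
      ((3, 3), (1, 4), (1, 5)); ((1, 3), (2, 4), (1, 6)); ((2, 3), (1, 4), (1, 6));
      ((1, 3), (1, 4), (2, 7)); ((2, 3), (1, 4), (1, 7)); ((1, 3), (1, 4), (2, 8));
      ((1, 3), (2, 4), (1, 8)); ((1, 3), (3, 4), (1, 8)); ((2, 3), (1, 4), (1, 8));
      ((2, 3), (3, 4), (1, 8)); ((1, 3), (1, 4), (2, 9)); ((1, 3), (2, 4), (1, 9));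
      ((2, 3), (1, 4), (1, 10)); ((2, 3), (1, 4), (1, 12)); ((1, 3), (2, 4), (1, 17));
      ((2, 3), (1, 4), (1, 17)); ((1, 3), (1, 5), (4, 6)); ((1, 3), (2, 5), (1, 6));
      ((1, 3), (1, 5), (2, 7)); ((1, 3), (1, 5), (4, 7)); ((1, 3), (2, 5), (1, 7));
      ((3, 3), (1, 5), (1, 7)); ((1, 3), (1, 5), (2, 9)); ((2, 3), (1, 5), (1, 9));
      ((1, 3), (2, 6), (1, 8)); ((1, 3), (1, 7), (2, 7)); ((1, 4), (2, 4), (1, 5));
      ((2, 4), (1, 5), (1, 6))].

(* Main.v *)
(* In a universal triple every n missed by the terms whose parameters are
   already known must use a term with an unknown parameter, whose least possible
   unknown value is therefore at most n.  As p_m(x) >= m for x >= 2, this bounds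
   the next parameter and yields a finite search tree; each of its leaves is on
   the list, violates a hypothesis, or misses some n <= 826. *)
Require Import Defs.
From mathcomp Require Import all_boot all_order all_algebra.
From mathcomp Require Import zify ring.

Set Implicit Arguments.
Unset Strict Implicit.
Unset Printing Implicit Defensive.

(** * Polygonal numbers as natural numbers *)

(** The binomial form is free of division, and its subtraction is exact for [m >= 2]. *)
Definition polygonal_nat (m x : nat) : nat := x + (m - 2) * 'C(x, 2).

Section Cast.
Import GRing.Theory Num.Theory.
Local Open Scope ring_scope.

Lemma polygonal_natE (m x : nat) :
  (2 <= m)%N -> polygonal m x = (polygonal_nat m x)%:R.
Proof.
case: m => [|[|m]] // _; rewrite /polygonal_nat subSS subSS subn0.
elim: x => [|x IHx]; first by rewrite /polygonal bin0n muln0 addn0; field.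
have -> : (x.+1 + m * 'C(x.+1, 2) = x + m * 'C(x, 2) + (1 + m * x))%N.
  by rewrite binS bin1; ring.
by rewrite natrD -IHx /polygonal natrD natrM -!natr1; field.
Qed.

Lemma universal_nat (a b c i j k : nat) :
  (2 <= i)%N -> (2 <= j)%N -> (2 <= k)%N -> universal ((a, i), (b, j), (c, k)) ->
  forall n, exists x y z,
    n = (a * polygonal_nat i x + b * polygonal_nat j y + c * polygonal_nat k z)%N.
Proof.
move=> hi hj hk + n => /(_ n)[x [y [z]]].
rewrite !polygonal_natE // -!natrM -!natrD => /eqP.
by rewrite eqr_nat => /eqP ->; exists x, y, z.
Qed.

End Cast.

Lemma polygonal_nat_ge (m x : nat) : m <= polygonal_nat m x.+2.
Proof.
rewrite /polygonal_nat; have : 0 < 'C(x.+2, 2) by rewrite bin_gt0.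
by case: 'C(_, _) => // t _; rewrite mulnS; lia.
Qed.

(** * Partially known terms and their values *)

(* What is known of a term [a p_m]: [Free l] means [l <= a], [Scaled a l] means
   that [a] is known and [l <= m]. *)
Variant term := Free of nat | Scaled of nat & nat | Fixed of nat & nat.

Definition fits (f : term) (a m : nat) : bool :=
  match f with
  | Free l => l <= a
  | Scaled a' l => (a == a') && (l <= m)
  | Fixed a' m' => (a == a') && (m == m')
  end.

(* The numbers [v + x d + 'C(x, 2) e <= B]. *)
Fixpoint quadratic_values (fuel v d e B : nat) : seq nat :=
  if fuel is fuel'.+1 then
    if v <= B then v :: quadratic_values fuel' (v + d) (d + e) e B else [::]
  else [::].

Definition known_values (B : nat) (f : term) : seq nat :=
  match f with
  | Free _ => [:: 0]
  | Scaled a _ => [:: 0; a]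
  | Fixed a m => quadratic_values B.+1 0 a (a * (m - 2)) B
  end.

(** A lower bound for the values outside [known_values]: a nonzero value is at least [a]; once [a]
    is known, the arguments 0 and 1 give 0 and [a] for every [m], and larger ones give at least
    [a * m]. *)
Definition least_unknown (f : term) : option nat :=
  match f with
  | Free l => Some l
  | Scaled a l => Some (a * l)
  | Fixed _ _ => None
  end.

Definition open_at (n : nat) (f : term) : bool :=
  if least_unknown f is Some v then v <= n else false.

Lemma mem_quadratic_values fuel v d e B x : x < fuel ->
  v + x * d + 'C(x, 2) * e <= B ->
  v + x * d + 'C(x, 2) * e \in quadratic_values fuel v d e B.
Proof.
elim: fuel v d x => // fuel IH v d x ltx leB /=.
rewrite ifT; last by apply: leq_trans leB; rewrite -addnA leq_addr.
case: x ltx leB => [|x] ltx leB; first by rewrite mul0n !addn0 mem_head.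
have eq_step : v + x.+1 * d + 'C(x.+1, 2) * e =
               v + d + x * (d + e) + 'C(x, 2) * e.
  by rewrite binS bin1; ring.
by rewrite inE eq_step IH ?orbT // -eq_step.
Qed.

Lemma fits_known_values B n f a m x : fits f a m -> 0 < a -> ~~ open_at n f ->
  a * polygonal_nat m x <= n -> n <= B ->
  a * polygonal_nat m x \in known_values B f.
Proof.
case: f => [l|a' l|a' m']; rewrite /open_at /= -?ltnNge.
- move=> le_la _ lt_nl le_n _.
  case: (posnP (polygonal_nat m x)) => [->|p_gt0]; first by rewrite muln0.
  by have : a <= a * polygonal_nat m x by [rewrite leq_pmulr]; lia.
- case/andP=> /eqP <- le_lm a_gt0 lt_nl le_n _.
  case: x le_n => [|[|x]] le_n; first by rewrite /polygonal_nat bin0n !muln0 inE.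
    by rewrite /polygonal_nat bin_small // muln0 addn0 muln1 !inE eqxx orbT.
  have : a * l <= a * polygonal_nat m x.+2.
    by rewrite leq_mul2l (leq_trans le_lm) ?orbT ?polygonal_nat_ge.
  by move: lt_nl le_n; lia.
- case/andP=> /eqP <- /eqP <- a_gt0 _ le_n le_B.
  have leB := leq_trans le_n le_B.
  have eq_val : a * polygonal_nat m x = 0 + x * a + 'C(x, 2) * (a * (m - 2)).
    by rewrite /polygonal_nat; ring.
  rewrite eq_val; apply: (@mem_quadratic_values B.+1 0 a); rewrite -?eq_val //.
  (* Since [a > 0], the argument [x] is at most the value, hence at most [B]: the fuel [B.+1]
     suffices. *)
  by rewrite ltnS (leq_trans _ leB) // (leq_trans _ (leq_pmull _ a_gt0)) ?leq_addr.
Qed.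

(** * Sums of known values and gaps *)

(* Sets of numbers below a fixed bound are encoded by their characteristic
   sequence [M], whose size is the bound. *)
Definition sumset (vs : seq nat) (M : bitseq) : bitseq :=
  foldr (fun v acc => [seq p.1 || p.2 | p <- zip acc (ncons v false M)])
    (nseq (size M) false) vs.

Lemma size_sumset vs M : size (sumset vs M) = size M.
Proof.
elim: vs => [|v vs IH] /=; first by rewrite size_nseq.
by rewrite size_map size_zip size_ncons IH; apply/minn_idPl; rewrite leq_addl.
Qed.

Lemma nth_sumset vs M v n : v \in vs -> nth false M n -> v + n < size M ->
  nth false (sumset vs M) (v + n).
Proof.
move=> + Mn lt_size; elim: vs => // w vs IH; rewrite inE /=.
have size_le : size (sumset vs M) <= size (ncons w false M).
  by rewrite size_ncons size_sumset leq_addl.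
rewrite (nth_map (false, false)) ?size_zip ?(minn_idPl size_le) ?size_sumset //.
rewrite nth_zip_cond size_zip (minn_idPl size_le) size_sumset lt_size /=.
case/orP=> [/eqP <-|/IH ->] //.
by rewrite nth_ncons ltnNge leq_addr /= addKn Mn orbT.
Qed.

(** The initial sequence [true :: nseq B false] encodes the set {0}. *)
Definition known_sums (B : nat) (f g h : term) : bitseq :=
  sumset (known_values B f) (sumset (known_values B g)
    (sumset (known_values B h) (true :: nseq B false))).

Lemma nth_known_sums B f g h u v w : u \in known_values B f ->
  v \in known_values B g -> w \in known_values B h -> u + v + w <= B ->
  nth false (known_sums B f g h) (u + v + w).
Proof.
move=> hu hv hw leB; rewrite -addnA -[w]addn0.
have sizeE : size (true :: nseq B false) = B.+1 by rewrite /= size_nseq.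
by do 3![apply: nth_sumset; rewrite ?size_sumset ?sizeE //; try lia].
Qed.

(** If every number up to [B] is a known sum, [index] returns the size [B.+1], and the next bound is
    tried. *)
Fixpoint gap (Bs : seq nat) (f g h : term) : option nat :=
  if Bs is B :: Bs' then
    let n := index false (known_sums B f g h) in
    if n <= B then Some n else gap Bs' f g h
  else None.

Lemma size_known_sums B f g h : size (known_sums B f g h) = B.+1.
Proof. by rewrite !size_sumset /= size_nseq. Qed.

(** Were all terms closed at [n], each summand, being at most [n], would be a known value, and [n] a
    known sum. *)
Lemma gap_open Bs f g h n a i b j c k x y z :
  gap Bs f g h = Some n ->
  n = a * polygonal_nat i x + b * polygonal_nat j y + c * polygonal_nat k z ->
  fits f a i -> fits g b j -> fits h c k -> 0 < a -> 0 < b -> 0 < c ->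
  [|| open_at n f, open_at n g | open_at n h].
Proof.
move=> gapE nE fit_f fit_g fit_h a_gt0 b_gt0 c_gt0.
apply: contraPT gapE; rewrite !negb_or => /and3P[closed_f closed_g closed_h].
elim: Bs => //= B Bs IH; case: leqP => // le_B [nI]; rewrite nI in le_B.
have nth_n : nth false (known_sums B f g h) n = false.
  by rewrite -[in LHS]nI nth_index // -index_mem nI size_known_sums ltnS.
suff: nth false (known_sums B f g h) n by rewrite nth_n.
rewrite nE; apply: nth_known_sums; rewrite -?nE //;
  apply: (fits_known_values (n := n)) => //; lia.
Qed.

(** * The search tree *)

Definition split (f : term) : term * term :=
  match f with
  | Free l => (Scaled l 3, Free l.+1)
  | Scaled a l => (Fixed a l, Scaled a l.+1)
  | Fixed _ _ => (f, f)
  end.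

Lemma fits_split f a m : 3 <= m -> fits f a m ->
  fits (split f).1 a m || fits (split f).2 a m.
Proof.
move=> m_ge3; case: f => [l|a' l|a' m'] /=; last by move=> ->.
  by rewrite leq_eqVlt eq_sym => /orP[->|->]; rewrite ?m_ge3 ?orbT.
by case/andP=> ->; rewrite leq_eqVlt eq_sym.
Qed.

(** The answer [true] is a certificate: exhausted fuel or a missing gap gives [false]. Along second
    branches the gap stays the same while the bound of the open term grows, until the term
    closes. *)
Fixpoint search (ok : pred polygonal_triple) (Bs : seq nat) (fuel : nat)
    (f g h : term) : bool :=
  if fuel is fuel'.+1 then
    if (if (f, g, h) is (Fixed a i, Fixed b j, Fixed c k)
        then ok ((a, i), (b, j), (c, k)) else false) then true
    else if gap Bs f g h is Some n then
      if open_at n f then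
        search ok Bs fuel' (split f).1 g h && search ok Bs fuel' (split f).2 g h
      else if open_at n g then
        search ok Bs fuel' f (split g).1 h && search ok Bs fuel' f (split g).2 h
      else if open_at n h then
        search ok Bs fuel' f g (split h).1 && search ok Bs fuel' f g (split h).2
      else true
    else false
  else false.

Lemma searchP ok Bs fuel f g h a i b j c k :
  search ok Bs fuel f g h -> universal ((a, i), (b, j), (c, k)) ->
  0 < a -> 0 < b -> 0 < c -> 3 <= i -> 3 <= j -> 3 <= k ->
  fits f a i -> fits g b j -> fits h c k -> ok ((a, i), (b, j), (c, k)).
Proof.
move=> + univ a_gt0 b_gt0 c_gt0 i_ge3 j_ge3 k_ge3.
have nat_univ := universal_nat (ltnW i_ge3) (ltnW j_ge3) (ltnW k_ge3) univ.
elim: fuel f g h => //= fuel IH f g h + fit_f fit_g fit_h.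
case: ifP => [|_].
  case: f g h fit_f fit_g fit_h => [?|? ?|? ?] [?|? ?|? ?] [?|? ?|? ?] //=.
  by do 3![case/andP=> /eqP -> /eqP ->].
case gapE: gap => [n|] //; have [x [y [z nE]]] := nat_univ n.
have := gap_open gapE nE fit_f fit_g fit_h a_gt0 b_gt0 c_gt0.
case: ifP => _ /=.
  by case/orP: (fits_split i_ge3 fit_f) => fit _ /andP[sl sr];
    [apply: IH sl _ _ _ | apply: IH sr _ _ _].
case: ifP => _ /=.
  by case/orP: (fits_split j_ge3 fit_g) => fit _ /andP[sl sr];
    [apply: IH sl _ _ _ | apply: IH sr _ _ _].
(* The first two terms are closed at the gap, so the third is open; a leaf with no open term
   contradicts universality. *)
by move=> ->; case/orP: (fits_split k_ge3 fit_h) => fit /andP[sl sr];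
  [apply: IH sl _ _ _ | apply: IH sr _ _ _].
Qed.

(** The hypotheses are tested only at the leaves, so the bounds on the three terms stay
    independent. *)
Definition admissible_on_list (t : polygonal_triple) : bool :=
  let: ((a, i), (b, j), (c, k)) := t in
  [&& 1 < maxn a (maxn b c), i <= j, j <= k, 5 <= maxn i (maxn j k),
    (i == j) ==> (a <= b) & (j == k) ==> (b <= c)] ==> (t \in universal_list).

(* Most gaps are below 50, which keeps the sumsets short. *)
Lemma search_admissible :
  search admissible_on_list [:: 50; 826] 300 (Free 1) (Free 1) (Free 1).
Proof. by vm_compute. Qed.

Theorem theorem1p11 (a b c i j k : nat)
  (ha : 0 < a) (hb : 0 < b) (hc : 0 < c)
  (habc : 1 < maxn a (maxn b c))
  (hi : 3 <= i) (hj : 3 <= j) (hk : 3 <= k)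
  (hij : i <= j) (hjk : j <= k)
  (hijk : 5 <= maxn i (maxn j k))
  (huniv : universal ((a, i), (b, j), (c, k)))
  (hab : i = j -> a <= b)
  (hbc : j = k -> b <= c) :
  ((a, i), (b, j), (c, k)) \in universal_list.
Proof.
(* Fitting [Free 1] unfolds to positivity, so [ha hb hc] occur twice. *)
have := searchP search_admissible huniv ha hb hc hi hj hk ha hb hc.
move/implyP; apply; rewrite habc hij hjk hijk /=.
by apply/andP; split; apply/implyP => /eqP.
Qed.
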